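(* Let $m$ be a positive integer and let $(a_{1,m},\dots,a_{m,m})$ be the solution of the linear system \[ \sum_{k=1}^{m} k^{2j}\, a_{k,m} = \begin{cases} 1 & j=1,\\ 0 & 2\le j\le m,\end{cases}\qquad j=1,\dots,m, \] i.e. $\begin{bmatrix} 1 & 2^2 & \cdots & m^2\\ 1 & 2^4 & \cdots & m^4\\ \vdots & & & \vdots\\ 1 & 2^{2m} & \cdots & m^{2m}\end{bmatrix}\begin{bmatrix}a_{1,m}\\ \vdots\\ a_{m,m}\end{bmatrix}=\begin{bmatrix}1\\0\\ \vdots\\0\end{bmatrix}$. Then for each $1\le k\le m$, \[ a_{k,m}=(-1)^{k+1}\frac{2\binom{2m}{m-k}}{k^2\binom{2m}{m}}. \] *)

(* Defs.v *)
From HB Require Import structures.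
From mathcomp Require Import all_boot all_order all_algebra.

Set Implicit Arguments.
Unset Strict Implicit.
Unset Printing Implicit Defensive.

Import Order.TTheory GRing.Theory Num.Theory.

Local Open Scope ring_scope.

(* Ordinals start at 0: the ordinals j, k stand for the indices j.+1, k.+1 in
   1..m of the linear system. *)
Definition even_power_mx (R : numFieldType) (m : nat) : 'M[R]_m :=
  \matrix_(j < m, k < m) k.+1%:R ^+ (2 * j.+1).

Definition first_unit_col (R : numFieldType) (m : nat) : 'cV[R]_m :=
  \col_(j < m) (if j.+1 == 1%N then 1 else 0).

Definition is_solution (R : numFieldType) (m : nat) (a : 'cV[R]_m) : Prop :=
  even_power_mx R m *m a = first_unit_col R m.

(* Main.v *)
(** The alternating sum of [C(2m, i) (i - m)^(2j)] over [0 <= i <= 2m] is a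
    [2m]-th finite difference of a polynomial of degree [2j], hence vanishes
    for [j < m]. Its terms are symmetric about [i = m], and folding it there
    shows that the closed form solves the system. The matrix is a Vandermonde
    matrix in the distinct nodes [k^2] with its columns rescaled by [k^2], so
    the solution is unique. *)
Require Import Defs.
From HB Require Import structures.
From mathcomp Require Import all_boot all_order all_algebra.
From mathcomp Require Import ring zify.

Set Implicit Arguments.
Unset Strict Implicit.
Unset Printing Implicit Defensive.

Import Order.TTheory GRing.Theory Num.Theory.

Local Open Scope ring_scope.

(** Induction on [j] with [n] and [c] general: lowering the exponent replaces [n.+1] by [n] and [c]
    by [c - 1]. The case [j = 0] expands [(1 - 1) ^+ n.+1]. *)
Lemma alternating_binomial_power_sum (R : comNzRingType) (n j : nat) (c : R) :
  (j < n)%N ->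
  \sum_(i < n.+1) (-1) ^+ i * 'C(n, i)%:R * (i%:R - c) ^+ j = 0.
Proof.
elim: j n c => [|j IHj] [|n] c // lt_jn.
  transitivity ((1 - 1 : R) ^+ n.+1); last by rewrite subrr expr0n.
  rewrite exprBn; apply: eq_bigr => i _.
  by rewrite !expr1n expr0 !mulr1 mulr_natr.
(* Split one factor [i - c] and absorb [i] by [i C(n+1, i) = (n+1) C(n, i-1)]. *)
transitivity
  (\sum_(i < n.+2) i%:R * ((-1) ^+ i * 'C(n.+1, i)%:R * (i%:R - c) ^+ j)
   - c * \sum_(i < n.+2) (-1) ^+ i * 'C(n.+1, i)%:R * (i%:R - c) ^+ j).
  rewrite mulr_sumr -sumrB; apply: eq_bigr => i _; rewrite exprS; ring.
rewrite (IHj n.+1) 1?ltnW // mulr0 subr0 big_ord_recl mul0r add0r.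
transitivity (- n.+1%:R *
  \sum_(i < n.+1) (-1) ^+ i * 'C(n, i)%:R * (i%:R - (c - 1)) ^+ j).
  rewrite mulr_sumr; apply: eq_bigr => i _ /=; rewrite /bump add1n.
  have absorb : i.+1%:R * 'C(n.+1, i.+1)%:R = n.+1%:R * 'C(n, i)%:R :> R.
    by rewrite -!natrM mul_bin_diag.
  have -> : i.+1%:R - c = i%:R - (c - 1) by rewrite -natr1; ring.
  transitivity (- (-1) ^+ i * (i.+1%:R * 'C(n.+1, i.+1)%:R) *
                (i%:R - (c - 1)) ^+ j); first by rewrite exprS; ring.
  by rewrite absorb; ring.
by rewrite IHj // mulr0.
Qed.

(** The factor 2 counts the two equal halves of the folded sum; the right side is its middle term,
    where [0 ^+ j] is 1 exactly when [j = 0]. *)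
Lemma central_binomial_even_power_sum (R : comNzRingType) (m j : nat) :
  (j < m)%N ->
  2 * \sum_(k < m) (-1) ^+ k * 'C(2 * m, m - k.+1)%:R * k.+1%:R ^+ (2 * j)
  = 'C(2 * m, m)%:R * 0 ^+ j :> R.
Proof.
move=> lt_jm.
have := @alternating_binomial_power_sum R (2 * m) (2 * j) m%:R.
rewrite ltn_pmul2l // => /(_ lt_jm).
have -> : (2 * m).+1 = (m + (1 + m))%N by lia.
rewrite big_split_ord big_split_ord big_ord1 /= addn0 subrr.
set F := fun k : nat =>
  (-1) ^+ k * 'C(2 * m, m - k.+1)%:R * k.+1%:R ^+ (2 * j) : R.
have -> : \sum_(i < m) (-1) ^+ i * 'C(2 * m, i)%:R * (i%:R - m%:R) ^+ (2 * j)
  = - (-1) ^+ m * \sum_(k < m) F k.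
  rewrite (reindex_inj rev_ord_inj) mulr_sumr; apply: eq_bigr => k _ /=.
  have lt_km := ltn_ord k.
  have -> : (m - k.+1)%:R - m%:R = - k.+1%:R :> R by rewrite natrB //; ring.
  rewrite exprM sqrrN -exprM /F.
  have -> : (-1) ^+ (m - k.+1) = - (-1) ^+ m * (-1) ^+ k :> R.
    (* [m - k.+1] and [m + k.+1] have the same parity. *)
    transitivity ((-1) ^+ (m + k).+1 : R); last by rewrite exprS exprD; ring.
    by rewrite -signr_odd -[RHS]signr_odd; congr (_ ^+ nat_of_bool _); lia.
  by ring.
have -> : \sum_(i < m) (-1) ^+ (m + (1 + i)) * 'C(2 * m, m + (1 + i))%:R *
    ((m + (1 + i))%:R - m%:R) ^+ (2 * j) = - (-1) ^+ m * \sum_(k < m) F k.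
  rewrite mulr_sumr; apply: eq_bigr => k _.
  have lt_km := ltn_ord k.
  rewrite -bin_sub; last lia.
  have -> : (2 * m - (m + (1 + k)) = m - k.+1)%N by lia.
  rewrite natrD addrAC subrr add0r exprD exprD expr1 add1n /F; ring.
rewrite exprM [0 ^+ 2]expr0n /F => sum_eq0.
(* The three pieces share the sign [(-1) ^+ m], and multiplication by it is injective. *)
apply: (can_inj (signrMK (odd m))).
rewrite signr_odd; apply/esym/eqP; rewrite -subr_eq0; apply/eqP.
by rewrite -[RHS]sum_eq0; ring.
Qed.

Lemma even_power_mx_unit (R : numFieldType) (m : nat) :
  even_power_mx R m \in unitmx.
Proof.
pose node : 'rV[R]_m := \row_k k.+1%:R ^+ 2.
have -> : even_power_mx R m = Vandermonde m node *m diag_mx node.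
  apply/matrixP => i k.
  by rewrite mul_mx_diag !mxE -exprM -exprD mulnS addnC.
rewrite unitmxE det_mulmx det_diag det_Vandermonde unitrM !unitfE.
apply/andP; split; last first.
  by apply/prodf_neq0 => k _; rewrite mxE expf_neq0 // pnatr_eq0.
(* Squares of distinct positive integers stay distinct in characteristic 0. *)
apply/prodf_neq0 => i _; apply/prodf_neq0 => k lt_ik.
by rewrite !mxE subr_eq0 -!natrX eqr_nat eqn_exp2r // eqSS gtn_eqF.
Qed.

Definition closed_form_col (R : numFieldType) (m : nat) : 'cV[R]_m :=
  \col_k ((-1) ^+ (k.+1 + 1) * ((2 * 'C(2 * m, m - k.+1)%:R) /
           (k.+1%:R ^+ 2 * 'C(2 * m, m)%:R))).

Lemma closed_form_col_solution (R : numFieldType) (m : nat) :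
  is_solution (closed_form_col R m).
Proof.
apply/matrixP => j l; rewrite !mxE.
have bin_neq0 : 'C(2 * m, m)%:R != 0 :> R.
  by rewrite pnatr_eq0 -lt0n bin_gt0 leq_pmull.
transitivity ('C(2 * m, m)%:R^-1 * (2 * \sum_(k < m)
  (-1) ^+ k * 'C(2 * m, m - k.+1)%:R * k.+1%:R ^+ (2 * j)) : R).
  rewrite !mulr_sumr; apply: eq_bigr => k _; rewrite !mxE.
  have k_neq0 : k.+1%:R != 0 :> R by rewrite pnatr_eq0.
  (* The denominator [k.+1%:R ^+ 2] lowers the exponent [2 * j.+1] to [2 * j], which is below
     [2 * m]. *)
  rewrite mulnS exprD addn1 !exprS; field.
  by rewrite bin_neq0 nat1r k_neq0.
rewrite central_binomial_even_power_sum // mulKf // expr0n eqSS.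
by case: (j : nat).
Qed.

Theorem theorem2p2 (R : numFieldType) (m : nat) (m_gt0 : (0 < m)%N) :
  (exists! a : 'cV[R]_m, is_solution a) /\
  (forall a : 'cV[R]_m, is_solution a ->
   forall k : 'I_m,
     a k 0 = (-1) ^+ (k.+1 + 1) *
       ((2 * 'C(2 * m, m - k.+1)%:R) /
        (k.+1%:R ^+ 2 * 'C(2 * m, m)%:R))).
Proof.
(* Injectivity of the matrix yields both uniqueness and the formula. *)
have sol_eq (a : 'cV[R]_m) : is_solution a -> closed_form_col R m = a.
  move=> sol_a; apply: (can_inj (mulKmx (even_power_mx_unit R m))).
  by rewrite closed_form_col_solution sol_a.
split=> [|a /sol_eq <- k]; last by rewrite mxE.
by exists (closed_form_col R m); split; first exact: closed_form_col_solution.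
Qed.
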